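(* Let $N$ be a finite non-empty set of players; for each $\nu\in N$ let $K_\nu\subset\mathbb{R}^{n_\nu}$, let $\mathbb{R}^n=\prod_{\nu\in N}\mathbb{R}^{n_\nu}$ and $K=\prod_{\nu\in N}K_\nu$, let $X_\nu:K\rightrightarrows\mathbb{R}^{n_\nu}$ be a set-valued map and let $\theta_\nu:\mathbb{R}^n\to\mathbb{R}$ be a function. Let $\mathbb{R}^n$ be equipped with the Euclidean norm. Assume that for each player $\nu\in N$: 1. $K_\nu$ is a convex, closed and non-empty subset of $\mathbb{R}^{n_\nu}$; 2. $X_\nu$ is continuous with convex, compact and non-empty values; 3. $X_\nu(K)=\bigcup_{x\in K}X_\nu(x)$ is bounded; 4. $\theta_\nu$ is pseudo-continuous; and 5. $\theta_\nu(\cdot,x^{-\nu})$ is quasi-convex, for all $x^{-\nu}$. Then there exists a projected solution, that is, there exist $\hat{x}\in K$ and $\hat{y}\in\prod_{\nu\in N}X_\nu(\hat{x})$ such that $\hat{x}\in P_K(\hat{y})$ and, for every $\nu\in N$, $\theta_\nu(\hat{y})\le\theta_\nu(w^\nu,\hat{y}^{-\nu})$ for all $w^\nu\in X_\nu(\hat{x})$.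
   Context: Notation: a vector $x\in\mathbb{R}^n=\prod_{\nu\in N}\mathbb{R}^{n_\nu}$ is written $x=(x^\nu,x^{-\nu})$, where $x^\nu\in\mathbb{R}^{n_\nu}$ is the component of player $\nu$ and $x^{-\nu}\in\prod_{\mu\in N\setminus\{\nu\}}\mathbb{R}^{n_\mu}$ collects the components of the other players. Projection: for $A\subset\mathbb{R}^n$ and $z\in\mathbb{R}^n$, $P_A(z)=\{w\in A:\ \|z-w\|\le\|z-x\|\text{ for all }x\in A\}$. ''$\hat{x}$ is a projection of $\hat{y}$ onto $K$'' means $\hat{x}\in P_K(\hat{y})$. Set-valued maps: a set-valued map $T:X\rightrightarrows Y$ between topological spaces is lower semicontinuous at $x$ if for each open $V\subset Y$ with $T(x)\cap V\ne\emptyset$ there is a neighbourhood $\mathscr{V}_x$ of $x$ with $T(x')\cap V\ne\emptyset$ for every $x'\in\mathscr{V}_x$; it is upper semicontinuous at $x$ if for each open $V\subset Y$ with $T(x)\subset V$ there is a neighbourhood $\mathscr{V}_x$ of $x$ with $T(x')\subset V$ for every $x'\in\mathscr{V}_x$. $T$ is continuous if it is both upper and lower semicontinuous (at every point). Pseudo-continuity: a function $f:X\to\mathbb{R}$ on a topological space is upper pseudo-continuous if for any $x,y\in X$ with $f(x)<f(y)$ there is a neighbourhood $\mathscr{V}_x$ of $x$ such that $f(x')<f(y)$ for all $x'\in\mathscr{V}_x$; it is lower pseudo-continuous if $-f$ is upper pseudo-continuous; it is pseudo-continuous if it is both. *)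

(* Defs.v *)
From mathcomp Require Import all_boot all_order all_algebra.
From mathcomp Require Import all_classical all_reals all_analysis.
Import Order.TTheory GRing.Theory Num.Theory.
Import numFieldNormedType.Exports.

Set Implicit Arguments.
Unset Strict Implicit.
Unset Printing Implicit Defensive.

Local Open Scope classical_set_scope.
Local Open Scope ring_scope.

Section SetValuedMaps.
Context {X Y : topologicalType}.
Implicit Types (T : X -> set Y) (x : X).

Definition setmap_lsc_at T x :=
  forall V : set Y, open V -> T x `&` V !=set0 ->
    \forall x' \near x, T x' `&` V !=set0.

Definition setmap_usc_at T x :=
  forall V : set Y, open V -> T x `<=` V -> \forall x' \near x, T x' `<=` V.

Definition setmap_continuous T :=
  forall x, setmap_lsc_at T x /\ setmap_usc_at T x.

End SetValuedMaps.

(* Continuity of a set-valued map with domain D, for the topology induced on D.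
   Points outside D are isolated in subspace D, so nothing is required there. *)
Definition setmap_continuous_on {X Y : topologicalType} (D : set X)
    (T : X -> set Y) :=
  setmap_continuous (T : subspace D -> set Y).

Section PseudoContinuity.
Context {R : realType} {X : topologicalType}.
Implicit Type f : X -> R.

Definition upper_pseudo_continuous f :=
  forall x y, f x < f y -> \forall x' \near x, f x' < f y.

Definition lower_pseudo_continuous f :=
  upper_pseudo_continuous (fun x => - f x).

Definition pseudo_continuous f :=
  upper_pseudo_continuous f /\ lower_pseudo_continuous f.

End PseudoContinuity.

Definition quasiconvex {R : realType} {E : lmodType R} (f : E -> R) :=
  forall (u v : E) (t : R), 0 <= t -> t <= 1 ->
    f (t *: u + (1 - t) *: v) <= Num.max (f u) (f v).

Section StrategyProfiles.
Context {R : realType} {N : finType} {n_ : N -> nat}.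

(* R^n = \prod_nu R^(n_nu). The topologies involved (product topology here, and
   the sup-norm topology that the library puts on row vectors) are the usual
   Euclidean ones. *)
Definition profile := prod_topology (fun nu : N => 'rV[R]_(n_ nu)).

Definition prod_set (A : forall nu, set 'rV[R]_(n_ nu)) : set profile :=
  [set x | forall nu, A nu (x nu)].

(* The library norm on row vectors is the sup norm, which would give a
   different notion of projection. *)
Definition euclidean_norm (x : profile) : R :=
  Num.sqrt (\sum_(nu : N) \sum_(i < n_ nu) x nu ord0 i ^+ 2).

Definition euclidean_dist (x y : profile) : R :=
  euclidean_norm (fun nu => x nu - y nu).

Definition projection (A : set profile) (z : profile) : set profile :=
  [set w | A w /\ forall x, A x -> euclidean_dist z w <= euclidean_dist z x].

(* (u, x^{-nu}) : the profile x with its nu-th component replaced by u. *)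
Definition replace (x : profile) (nu : N) (u : 'rV[R]_(n_ nu)) : profile :=
  dfwith x nu u.

(* X_ nu is total, but only its values on prod_set K_ are used: it stands for a
   set-valued map with domain K. *)
Definition projected_solution (K_ : forall nu, set 'rV[R]_(n_ nu))
    (X_ : forall nu, profile -> set 'rV[R]_(n_ nu))
    (theta : N -> profile -> R) (xhat yhat : profile) :=
  [/\ prod_set K_ xhat,
      prod_set (fun nu => X_ nu xhat) yhat,
      projection (prod_set K_) yhat xhat &
      forall nu (w : 'rV[R]_(n_ nu)), X_ nu xhat w ->
        theta nu yhat <= theta nu (replace yhat w)].

End StrategyProfiles.

Arguments profile R {N} n_.

(* Main.v *)
(** Player by player, the Euclidean projection onto K is a continuous map P
    (it is nonexpansive on each closed convex K_nu).  Send a profile y to the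
    set of all w such that w^nu minimizes theta_nu(., y^{-nu}) over X_nu(P y)
    for every nu.  By Berge's maximum theorem, which only needs
    pseudo-continuity, this map has a closed graph; its values are non-empty
    and convex.  Since the sets X_nu are bounded, a large simplex, mapped
    affinely onto a neighbourhood of all of them, is sent into itself, and
    Kakutani's theorem gives a fixed point yhat; then xhat = P yhat.

    Kakutani's theorem is obtained from Brouwer's by a partition of unity on a
    finite net, and Brouwer's theorem from Scarf's combinatorial lemma in the
    form of Petri and Voorneveld: colour a point x of the grid of mesh 1/m in
    the simplex by an index i with x_i <= f(x)_i.  A group of grid points that
    uses exactly the colours C and such that no grid point beats all of it in
    every coordinate of C has diameter O(1/m), and its coordinates outside C
    are O(1/m).  No such group can therefore accumulate at a point where
    f(x)_i < x_i for some i. *)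
Require Import Defs.
From mathcomp Require Import all_boot all_order all_algebra.
From mathcomp Require Import zify ring lra.

Set Implicit Arguments.
Unset Strict Implicit.
Unset Printing Implicit Defensive.

(** * Scarf's combinatorial lemma *)

(* The dummies [e i] stand for the facets of a simplex: adding them to the real
   elements makes all cells have exactly [#|I|] elements ("rooms"), separated by
   "doors" of [#|I| - 1] elements.  Counting the doors with colours [~ i0] in
   two ways, a room has an odd number of them iff it is fully coloured, while
   every door is in two rooms, except the door made of dummies only, which is
   in one.  Hence the number of fully coloured rooms is odd. *)
Section Scarf.
Variables (U I : finType) (r : I -> U -> nat) (e : I -> U) (c : U -> I).
Variables (i0 : I) (t0 : U).
Hypothesis r_inj : forall i, injective (r i).
Hypothesis e_min : forall i u, r i (e i) <= r i u.
Hypothesis e_max : forall i j u, i != j -> u \notin codom e -> r i u < r i (e j).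
Hypothesis eK : cancel e c.
Hypothesis t0_real : t0 \notin codom e.

Definition dominated (S : {set U}) (y : U) (i : I) :=
  [forall x in S, r i y <= r i x].

(** For non-empty [S]: no element exceeds the minimum of [S] in all the orders at once. The dominant
    sets with [#|I|] elements are Scarf's primitive sets. *)
Definition dominant (S : {set U}) := [forall y, exists i, dominated S y i].

Lemma dominatedP (S : {set U}) y i :
  reflect {in S, forall x, r i y <= r i x} (dominated S y i).
Proof. exact: forall_inP. Qed.

Lemma dominantP (S : {set U}) : reflect (forall y, exists i, dominated S y i) (dominant S).
Proof.
apply: (iffP forallP) => h y; first by have /existsP := h y.
by apply/existsP.
Qed.

Lemma dominated_sub (S S' : {set U}) y i :
  S' \subset S -> dominated S y i -> dominated S' y i.
Proof.
by move=> /subsetP sub /dominatedP dS; apply/dominatedP => x /sub; exact: dS.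
Qed.

Lemma dominant_sub (S S' : {set U}) : S' \subset S -> dominant S -> dominant S'.
Proof.
move=> sub /dominantP dS; apply/dominantP => y.
by have [i iS] := dS y; exists i; exact: dominated_sub iS.
Qed.

(** If [c] maps [S] bijectively to [I], only the element of colour [i0] can be removed. Otherwise a
    removable [x] shares its colour with exactly one other element [x'], and these two are the only
    removable ones. *)
Lemma room_degree (S : {set U}) : #|S| = #|I| ->
  odd #|[set x in S | c @: (S :\ x) == [set~ i0]]| = (c @: S == [set: I]).
Proof.
move=> cardS.
have c_inj x : x \in S -> c @: (S :\ x) = [set~ i0] -> {in S :\ x &, injective c}.
  move=> xS cSx; apply/imset_injP; rewrite cSx cardsC1.
  by have := cardsD1 x S; rewrite xS cardS => ->.
case: eqP => [cS | ncS].
  have injS : {in S &, injective c} by apply/imset_injP; rewrite cS cardsT cardS.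
  have /imsetP[x xS i0x] : i0 \in c @: S by rewrite cS inE.
  suff -> : [set x in S | c @: (S :\ x) == [set~ i0]] = [set x] by rewrite cards1.
  apply/setP => z; rewrite !inE; apply/andP/eqP => [[zS /eqP cSz]|->].
    apply/eqP; apply: contraT => zx.
    suff : i0 \in [set~ i0] by rewrite !inE eqxx.
    by rewrite -cSz i0x; apply: imset_f; rewrite !inE eq_sym zx.
  split=> //; apply/eqP/setP => j; rewrite !inE; apply/imsetP/idP.
    move=> [y]; rewrite !inE => /andP[yx yS] ->; rewrite i0x.
    by apply: contra yx => /eqP /injS ->.
  move=> ji0; have /imsetP[y yS jy] : j \in c @: S by rewrite cS inE.
  by exists y => //; rewrite !inE yS andbT; apply: contra ji0 => /eqP yx; rewrite jy yx i0x.
set Q := [set x in S | _].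
have [->|[x]] := set_0Vmem Q; first by rewrite cards0.
rewrite inE => /andP[xS /eqP cSx].
have cx : c x \in c @: (S :\ x).
  rewrite cSx !inE; apply/eqP => cxi0; apply: ncS.
  by rewrite -(setD1K xS) imsetU1 cSx cxi0 setUCr.
have /imsetP[x' x'S cxx'] := cx.
have [x'x x'S'] : x' != x /\ x' \in S by move: x'S; rewrite !inE => /andP.
suff -> : Q = [set x; x'] by rewrite cards2 eq_sym x'x.
apply/setP => w; rewrite !inE; apply/andP/orP => [[wS /eqP cSw]|].
  case: (eqVneq w x) => [|wx]; [by left|right].
  apply: contraT => wx'; move/eqP: (x'x); case.
  by apply/esym/(c_inj _ wS cSw); rewrite ?inE // eq_sym ?wx ?wx'.
case=> /eqP ->; split => //; first exact/eqP.
set A := S :\ x :\ x'.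
have Sx' : S :\ x' = x |: A.
  by apply/setP => z; rewrite !inE; case: (eqVneq z x) => [->|]; rewrite ?xS ?(eq_sym x) ?x'x.
have Sx : S :\ x = x' |: A by rewrite /A setD1K // !inE x'x.
by rewrite -cSx Sx Sx' !imsetU1 cxx'.
Qed.

Let D0 := e @: [set~ i0].

Let e_inj : injective e := can_inj eK.

Let e_inD0 j : (e j \in D0) = (j != i0).
Proof. by rewrite (mem_imset _ _ e_inj) !inE. Qed.

Lemma card_exceptional : #|D0|.+1 = #|I|.
Proof. by rewrite card_imset // cardsC1 prednK //; apply/card_gt0P; exists i0. Qed.

Lemma dominated_dummy (S : {set U}) y i : e i \in S -> dominated S y i -> y = e i.
Proof.
by move=> eS /dominatedP /(_ _ eS) le; apply: (@r_inj i); apply/eqP; rewrite eqn_leq le e_min.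
Qed.

(** In an order [j != i0] the dummy [e j] of [D0] is minimal. So the largest real element [m] of
    order [i0] can be below [x |: D0] only in order [i0], which forces [x = m]. *)
Lemma exceptional_degree : #|[set x | x \notin D0 & dominant (x |: D0)]| = 1.
Proof.
case: (@arg_maxnP _ t0 [predC codom e] (r i0) t0_real) => m /= m_real m_max.
have mD0 : m \notin D0 by apply: contra m_real => /imsetP[j _ ->]; exact: codom_f.
suff -> : [set x | x \notin D0 & dominant (x |: D0)] = [set m] by rewrite cards1.
apply/setP => x; rewrite !inE; apply/andP/eqP => [[xD0 /dominantP dx]|->].
  have [j mj] := dx m.
  have jE : j = i0.
    apply/eqP; apply: contraT => ji0.
    have := dominated_dummy _ mj; rewrite !inE e_inD0 ji0 orbT => /(_ isT) me.
    by move: m_real; rewrite me codom_f.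
  rewrite jE in mj; apply: (@r_inj i0); apply/eqP; rewrite eqn_leq.
  move/dominatedP : (mj) => -> /=; last by rewrite !inE eqxx.
  rewrite andbT; apply: m_max; apply/codomP => -[k xk].
  move: xD0; rewrite xk e_inD0 negbK => /eqP ki0.
  have := dominated_dummy _ mj; rewrite xk ki0 !inE eqxx => /(_ isT) me.
  by move: m_real; rewrite me codom_f.
split=> //; apply/dominantP => y.
case: (boolP (y \in codom e)) => [/codomP[k ->]|y_real].
  by exists k; apply/dominatedP => z _; exact: e_min.
exists i0; apply/dominatedP => z; rewrite !inE => /orP[/eqP ->|].
  exact: m_max.
by case/imsetP => k; rewrite !inE => ki0 ->; apply/ltnW/e_max => //; rewrite eq_sym.
Qed.

(* The map [lo], sending i to the minimum of D in order i, is onto D and hence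
   identifies exactly one pair a, b of indices.  A room around D is obtained by
   adding, for j = a or j = b, the largest element in order j among those that
   exceed the minimum of D in all the other orders. *)
Lemma door_degree (D : {set U}) : dominant D -> c @: D = [set~ i0] ->
  #|D|.+1 = #|I| -> D != D0 ->
  #|[set x | x \notin D & dominant (x |: D)]| = 2.
Proof.
move=> /dominantP domD cD cardD DD0.
(* If [D] has only dummies other than [e i], it has all of them by cardinality, and its colours
   force [i = i0], so that [D = D0]. *)
have subD0 i : (forall z, z \in D -> z \in codom e /\ z != e i) -> False.
  move=> sub; have sub' : D \subset e @: [set~ i].
    apply/subsetP => z /sub[/codomP[k ->]] ek; apply: imset_f; rewrite !inE.
    by apply: contra ek => /eqP ->.
  have DE : D = e @: [set~ i].
    apply/eqP; rewrite eqEcard sub' card_imset // cardsC1.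
    by rewrite -cardD leqnn.
  have : c @: D = [set~ i].
    rewrite DE -imset_comp; under eq_imset => z do rewrite /= eK.
    by rewrite imset_id.
  rewrite cD => /setP /(_ i); rewrite !inE eqxx => /negbFE /eqP ii0.
  by rewrite DE ii0 eqxx in DD0.
have [d0 d0D] : exists d, d \in D.
  have [D00|[d dD]] := set_0Vmem D; last by exists d.
  by case: (subD0 i0) => z; rewrite D00 inE.
pose lo i := [arg min_(z < d0 in D) r i z].
have loD i : lo i \in D by rewrite /lo; case: arg_minnP.
have lo_min i x : x \in D -> r i (lo i) <= r i x.
  by rewrite /lo; case: arg_minnP => // z _ h; exact: h.
have lo_eq i z : z \in D -> dominated D z i -> z = lo i.
  move=> zD /dominatedP /(_ _ (loD i)) le; apply: (@r_inj i); apply/eqP.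
  by rewrite eqn_leq le lo_min.
have lo_onto z : z \in D -> exists i, z = lo i.
  by move=> zD; have [i /(lo_eq _ _ zD)] := domD z; exists i.
have lo_im (A : {set I}) : {in D, forall z, exists2 i, i \in A & z = lo i} ->
    #|A| <= #|D| -> {in A &, injective lo}.
  move=> h cA; apply/imset_injP; rewrite eqn_leq leq_imset_card /=.
  apply: leq_trans cA _; apply: subset_leq_card; apply/subsetP => z /h[i iA ->].
  exact: imset_f.
have [a [b [ab loab]]] : exists a b, a != b /\ lo a = lo b.
  have : ~~ injectiveb lo.
    apply/injectiveP => lo_inj.
    have : #|lo @: [set: I]| <= #|D|.
      by apply: subset_leq_card; apply/subsetP => z /imsetP[i _ ->].
    by rewrite card_imset // cardsT -cardD ltnn.
  by case/injectivePn => a [b ab loab]; exists a, b; split=> //; exact: loab.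
have lo_onto' j : j \in [set a; b] ->
    {in D, forall z, exists2 i, i \in [set~ j] & z = lo i}.
  move=> jab z /lo_onto[i ->].
  case: (eqVneq i j) => [->|ij]; last by exists i => //; rewrite !inE.
  move: jab; rewrite !inE => /orP[]/eqP ->.
    by exists b; rewrite ?inE 1?eq_sym.
  by exists a; rewrite ?inE.
have lo_inj' j : j \in [set a; b] -> {in [set~ j] &, injective lo}.
  by move=> /lo_onto' h; apply: lo_im h _; rewrite cardsC1 -cardD leqnn.
pose M j : pred U := fun y => [forall i, (i != j) ==> (r i (lo i) < r i y)].
have MP j y : reflect (forall i, i != j -> r i (lo i) < r i y) (M j y).
  by apply: (iffP forallP) => h i; [move=> ij; have /implyP := h i; exact | apply/implyP; exact: h].
(* Hence the maximum defining [top j] ranges over a non-empty set. If [e j] failed in an order [i],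
   all of [D] would lie above it there, and so consist of dummies other than [e i]. *)
have Me j : M j (e j).
  apply/MP => i ij; rewrite ltnNge; apply/negP => le; apply: (subD0 i) => z zD.
  have lez := leq_trans le (lo_min i z zD).
  split; first by apply: contraT => z_real; have := e_max ij z_real; rewrite ltnNge lez.
  apply/eqP => ze; move: lez; rewrite ze => lez.
  have /(@r_inj i)/e_inj ji : r i (e j) = r i (e i) by apply/eqP; rewrite eqn_leq lez e_min.
  by rewrite ji eqxx in ij.
pose top j := [arg max_(y > e j | M j y) r j y].
have topM j : M j (top j) by rewrite /top; case: arg_maxnP => //; exact: Me.
have top_max j y : M j y -> r j y <= r j (top j).
  by rewrite /top; case: arg_maxnP; [exact: Me | move=> z _ h; exact: h].
have M_dominated j y i : M j y -> dominated D y i -> i = j.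
  move=> /MP My /dominatedP /(_ _ (loD i)) le; apply/eqP; apply: contraT => ij.
  by have := My i ij; rewrite ltnNge le.
have top_notin j : j \in [set a; b] -> top j \notin D.
  move=> jab; apply/negP => tD; have [i] := lo_onto' j jab _ tD.
  by rewrite !inE => ij ti; have /MP /(_ _ ij) := topM j; rewrite ti ltnn.
have top_dominant j : dominant (top j |: D).
  apply/dominantP => y; case: (boolP (M j y)) => [My|].
    exists j; have [k yk] := domD y; have kj := M_dominated _ _ _ My yk; subst k.
    apply/dominatedP => x; rewrite !inE => /orP[/eqP ->|]; first exact: top_max.
    by move/dominatedP: yk; apply.
  rewrite negb_forall => /existsP[i]; rewrite negb_imply -leqNgt => /andP[ij le].
  exists i; apply/dominatedP => x; rewrite !inE => /orP[/eqP ->|xD].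
    by apply: (leq_trans le); apply: ltnW; have /MP := topM j; exact.
  exact: leq_trans le (lo_min _ _ xD).
have top_neq : top a != top b.
  apply/eqP => tt; have := domD (top a) => -[k ka].
  have kE := M_dominated _ _ _ (topM a) ka.
  have kE' : k = b by apply: M_dominated ka; rewrite tt; exact: topM.
  by move: ab; rewrite -kE -kE' eqxx.
suff -> : [set x | x \notin D & dominant (x |: D)] = [set top a; top b].
  by rewrite cards2 top_neq.
apply/setP => x; rewrite !inE; apply/andP/orP; last first.
  by case=> /eqP ->; rewrite top_notin ?inE ?eqxx ?orbT.
(* Conversely, an added [x] is the new minimum in some order [j]. Every element of [D] must stay
   minimal in another order, so [lo] is injective off [j], and [j] is [a] or [b]. *)
move=> [xD /dominantP domx].
have [j xj] := domx x.
have subx : D \subset x |: D by exact: subsetU1.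
have xj_lt : r j x < r j (lo j).
  have /dominatedP /(_ _ (loD j)) := dominated_sub subx xj.
  rewrite leq_eqVlt => /orP[/eqP /(@r_inj j) xlo|//].
  by rewrite xlo loD in xD.
have other z : z \in D -> exists2 i, i \in [set~ j] & z = lo i.
  move=> zD; have [i zi] := domx z; exists i.
    rewrite !inE; apply/eqP => ij; rewrite ij in zi.
    have := lo_eq _ _ zD (dominated_sub subx zi).
    move/dominatedP: zi => /(_ x); rewrite !inE eqxx => /(_ isT) + zlo.
    by rewrite zlo leqNgt xj_lt.
  exact: lo_eq zD (dominated_sub subx zi).
have inj_j : {in [set~ j] &, injective lo}.
  by apply: lo_im => //; rewrite cardsC1 -cardD leqnn.
have jab : j \in [set a; b].
  rewrite !inE; apply: contraT; rewrite negb_or => /andP[ja jb].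
  by move: ab; rewrite (inj_j a b) ?eqxx // !inE eq_sym.
(* If [x] were below [lo i], the order in which [lo i] stays minimal would be [i] by injectivity,
   giving [x = lo i], an element of [D]. *)
have Mx : M j x.
  apply/MP => i ij; rewrite ltnNge; apply/negP => xi.
  have xdi : dominated D x i.
    by apply/dominatedP => z zD; exact: leq_trans xi (lo_min _ _ zD).
  have [k lok] := domx (lo i).
  have kj : k \in [set~ j].
    rewrite !inE; apply/eqP => kj; rewrite kj in lok.
    move/dominatedP : (lok) => /(_ x); rewrite !inE eqxx => /(_ isT).
    by rewrite -(lo_eq _ _ (loD i) (dominated_sub subx lok)) in xj_lt; rewrite leqNgt xj_lt.
  have ik : i = k.
    apply: inj_j => //; first by rewrite !inE.
    exact: lo_eq (loD i) (dominated_sub subx lok).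
  rewrite -ik in lok; move/dominatedP : lok => /(_ x); rewrite !inE eqxx => /(_ isT) lox.
  have /(@r_inj i) xlo : r i x = r i (lo i) by apply/eqP; rewrite eqn_leq xi lox.
  by rewrite xlo loD in xD.
have xtop : x = top j.
  apply: (@r_inj j); apply/eqP; rewrite eqn_leq top_max //=.
  have [k tk] := domx (top j).
  have kj := M_dominated _ _ _ (topM j) (dominated_sub subx tk).
  by rewrite -{1}kj; move/dominatedP: tk; rewrite kj; apply; rewrite !inE eqxx.
by move: jab; rewrite !inE xtop => /orP[]/eqP ->; rewrite eqxx; [left|right].
Qed.

Lemma scarf : exists2 S : {set U}, dominant S & c @: S = [set: I].
Proof.
pose room (S : {set U}) := dominant S && (#|S| == #|I|).
pose door (D : {set U}) := [&& dominant D, #|D|.+1 == #|I| & c @: D == [set~ i0]].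
pose deg (S : {set U}) := #|[set x in S | c @: (S :\ x) == [set~ i0]]|.
case: (boolP [exists S, room S && (c @: S == [set: I])]).
  by move=> /existsP[S /andP[/andP[dS _] /eqP cS]]; exists S.
rewrite negb_exists => /forallP none.
have even_rooms : ~~ odd (\sum_(S | room S) deg S).
  apply: (big_ind (fun n => ~~ odd n)) => // [x y xe ye|S rS].
    by rewrite oddD (negbTE xe) (negbTE ye).
  have /andP[_ /eqP kS] := rS.
  by rewrite /deg room_degree //; have := none S; rewrite rS.
(* Double counting: a room [S] with [x \in S] corresponds to a door [D] with [x \notin D] through
   [S = x |: D]. *)
have count : \sum_(S | room S) deg S =
    \sum_(D | door D) #|[set x | x \notin D & dominant (x |: D)]|.
  under eq_bigr => S _ do rewrite /deg -sum1_card.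
  under [RHS]eq_bigr => D _ do rewrite -sum1_card.
  rewrite (exchange_big_dep predT) //= [RHS](exchange_big_dep predT) //=.
  apply: eq_bigr => x _.
  rewrite (reindex_onto (fun D => x |: D) (fun S => S :\ x)) /=; last first.
    by move=> S /andP[_]; rewrite !inE => /andP[xS _]; rewrite setD1K.
  apply: eq_bigl => D; rewrite !inE eqxx /room /door.
  case: (boolP (x \in D)) => xD /=.
    rewrite andbF; apply/negbTE; rewrite negb_and; apply/orP; right.
    by apply/eqP => /setP /(_ x); rewrite !inE eqxx xD.
  rewrite setU1K // eqxx andbT cardsU1 xD add1n.
  case: (boolP (dominant (x |: D))) => dx /=; last by rewrite andbF.
  by rewrite (dominant_sub _ dx) ?subsetU1 //= andbT.
have door0 : door D0.
  apply/and3P; split; last 1 first.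
  - apply/eqP; rewrite /D0 -imset_comp; under eq_imset => z do rewrite /= eK.
    by rewrite imset_id.
  - have := exceptional_degree; case: (set_0Vmem [set x | x \notin D0 & dominant (x |: D0)]).
      by move=> ->; rewrite cards0.
    move=> [x]; rewrite inE => /andP[_ dx] _.
    by apply: dominant_sub dx; exact: subsetU1.
  - by apply/eqP; exact: card_exceptional.
move: even_rooms; rewrite count (bigD1 D0) //= exceptional_degree oddD /=.
rewrite negbK => /negPn; case/negP; apply: (big_ind (fun n => ~~ odd n)) => //.
  by move=> x y xe ye; rewrite oddD (negbTE xe) (negbTE ye).
move=> D /andP[/and3P[dD /eqP kD /eqP cD] DD0].
by rewrite door_degree.
Qed.

End Scarf.

(** * From Scarf's lemma to cells of the integer grid *)

(** This is [scarf] for [T] with one dummy per index, ties of [h i] being broken by [enum_rank]. As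
    [inr i] is least in order [i], a point of [T] below all of [S] in that order excludes [inr i]
    from [S], so colour [i] is carried by a point of [s]. *)
Lemma no_bullying (T I : finType) (h : I -> T -> nat) (c : T -> I) (t0 : T) :
  exists s : {set T},
    forall y, exists2 i, i \in c @: s & {in s, forall x, h i y <= h i x}.
Proof.
(* In order [i] the real elements take values from 1 to [B i - 1]; the dummy [inr i] sits at 0 and
   the other dummies start at [B i]. *)
pose B i := ((\max_t h i t).+1 * #|T|).+1.
pose r i (u : T + I) := match u with
  | inl t => (h i t * #|T| + enum_rank t).+1
  | inr j => if j == i then 0 else B i + enum_rank j end.
pose c' (u : T + I) := match u with inl t => c t | inr i => i end.
have rB i t : r i (inl t) < B i.
  rewrite /r /B ltnS; have le : h i t <= \max_t h i t by exact: leq_bigmax.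
  apply: leq_trans (_ : (h i t).+1 * #|T| <= _); last by rewrite leq_mul2r ltnS le orbT.
  by rewrite mulSn addnC ltn_add2r.
have rank_eq (a b : nat) (x y : T) :
    a * #|T| + enum_rank x <= b * #|T| + enum_rank y -> a <= b.
  move=> le; have := leq_div2r #|T| le.
  have T0 : 0 < #|T| by apply/card_gt0P; exists t0.
  by rewrite !divnMDl // !divn_small // !addn0.
have r_inj i : injective (r i).
  move=> [x|j] [y|k] /=.
  - move=> /succn_inj xy; have ab : h i x = h i y.
      apply/eqP; rewrite eqn_leq; apply/andP; split.
        by apply: (rank_eq _ _ x y); rewrite xy.
      by apply: (rank_eq _ _ y x); rewrite xy.
    by move: xy; rewrite ab => /addnI /val_inj /enum_rank_inj ->.
  - by case: ifP => // _ xk; have := rB i x; rewrite /= xk ltnNge leq_addr.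
  - by case: ifP => // _ xk; have := rB i y; rewrite /= -xk ltnNge leq_addr.
  - case: eqP => [->|_]; case: eqP => [->|_] //.
    by move=> /addnI /val_inj /enum_rank_inj ->.
have e_max i j u : i != j -> u \notin codom (@inr T I) -> r i u < r i (inr j).
  move=> ij; case: u => [t _|k]; last by rewrite codom_f.
  by rewrite {2}/r eq_sym (negbTE ij); apply: leq_trans (rB i t) _; exact: leq_addr.
have t0_real : inl t0 \notin codom (@inr T I) by apply/codomP => -[].
have e_min i u : r i (inr i) <= r i u by rewrite /r eqxx.
have inrK : cancel inr c' by [].
have [S /dominantP domS cS] := scarf (c t0) r_inj e_min e_max inrK t0_real.
exists [set t | inl t \in S] => y.
have [i /dominatedP iS] := domS (inl y); exists i.
  have : i \in c' @: S by rewrite cS inE.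
  move=> /imsetP[[t tS ->|j jS ij]]; first by apply: imset_f; rewrite inE.
  by have := iS _ jS; rewrite /= ij eqxx.
by move=> x; rewrite inE => /iS; rewrite /r ltnS; exact: rank_eq.
Qed.

(** Let [C] be the colours of [s] and [mu] its coordinatewise minimum. No grid point exceeds [mu] on
    all of [C], so [mu] sums over [C] to more than [m - n.+1]. For each point of [s], the excesses
    over [mu] on [C] and the coordinates outside [C] thus add up to less than [n.+1]. *)
Lemma grid_cell n m (c : {ffun 'I_n.+1 -> 'I_m.+1} -> 'I_n.+1) :
  exists s : {set {ffun 'I_n.+1 -> 'I_m.+1}}, [/\ s != set0,
    forall v, v \in s -> \sum_i v i = m,
    forall v w i, v \in s -> w \in s -> v i <= w i + n.+1 &
    forall v i, v \in s -> i \notin c @: s -> v i <= n.+1].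
Proof.
pose T := {v : {ffun 'I_n.+1 -> 'I_m.+1} | \sum_i v i == m}.
have t0P : \sum_i [ffun i : 'I_n.+1 => if i == ord0 then @ord_max m else ord0] i == m.
  rewrite (bigD1 ord0) //= ffunE eqxx big1 ?addn0 // => i /negbTE i0.
  by rewrite ffunE i0.
pose t0 : T := exist (fun v : {ffun _ -> _} => _) _ t0P.
have [s dom] := @no_bullying T _ (fun i v => val v i) (fun v => c (val v)) t0.
set C := _ @: s in dom.
have [i1 i1C _] := dom t0.
have [x0 x0s _] := imsetP i1C.
pose mu i := val (val [arg min_(x < x0 in s) val x i] i).
have mu_le i x : x \in s -> mu i <= val x i.
  by rewrite /mu; case: arg_minnP => // z _ h xs; exact: h.
have big_mu : m < \sum_(i in C) (mu i).+1.
  rewrite ltnNge; apply/negP => le.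
  (* otherwise y would beat all of s in every coordinate of C *)
  pose y' i := (mu i).+1 + (if i == i1 then m - \sum_(i in C) (mu i).+1 else 0).
  pose y i := if i \in C then y' i else 0.
  have sumy : \sum_i y i = m.
    rewrite (bigID (mem C)) /= [X in _ + X]big1 ?addn0; last first.
      by move=> i /negbTE iC; rewrite /y iC.
    rewrite (eq_bigr y'); last first.
      by move=> i iC; rewrite /y iC.
    rewrite big_split /= [X in _ + X](bigD1 i1) //= eqxx.
    rewrite [X in _ + (_ + X)]big1 ?addn0 ?subnKC //.
    by move=> i /andP[_ /negbTE ->].
  have y_lt i : y i < m.+1 by rewrite ltnS -sumy (bigD1 i) //= leq_addr.
  pose w : {ffun 'I_n.+1 -> 'I_m.+1} := [ffun i => inord (y i)].
  have wE i : w i = y i :> nat by rewrite ffunE inordK.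
  have wP : \sum_i w i == m by under eq_bigr do rewrite wE; rewrite sumy.
  have [i iC] := dom (exist _ w wP : T); rewrite /= wE /y iC => lemu.
  have : y i <= mu i.
    rewrite /mu; case: arg_minnP => // z zs _.
    by have := lemu z zs; rewrite /y iC.
  by rewrite /y iC /y' addSn ltnNge leq_addr.
have big_mu' : m < \sum_(i in C) mu i + n.+1.
  apply: leq_trans big_mu _; under eq_bigr do rewrite -addn1.
  rewrite big_split /= leq_add2l sum1_card.
  by apply: leq_trans (max_card _) _; rewrite card_ord.
have sumE x : x \in s -> \sum_i val x i = m by move=> _; apply/eqP; exact: (valP x).
have split_sum x : x \in s -> \sum_(i in C) val x i + \sum_(i | i \notin C) val x i = m.
  by move=> xs; apply: etrans (sumE x xs); rewrite [RHS](bigID (mem C)).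
have sum_mu x : x \in s -> \sum_(i in C) mu i <= \sum_(i in C) val x i.
  by move=> xs; apply: leq_sum => i _; exact: mu_le.
have out x i : x \in s -> i \notin C -> val x i <= n.+1.
  move=> xs iC; have := split_sum x xs; have := sum_mu x xs.
  move: big_mu'; rewrite [X in _ + X = _](bigD1 i) //=.
  by move: (\sum_(j in C) mu j) (\sum_(j in C) _) (\sum_(_ < _ | _) _) => *; lia.
have cval : [set c (val v) | v in s] = c @: (val @: s) by rewrite -imset_comp.
exists (val @: s); split.
- by apply/set0Pn; exists (val x0); exact: imset_f.
- by move=> _ /imsetP[x xs ->]; exact: sumE.
- move=> _ _ i /imsetP[x xs ->] /imsetP[y ys ->].
  case: (boolP (i \in C)) => iC; last by apply: leq_trans (out _ _ xs iC) _; exact: leq_addl.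
  have := split_sum x xs; have := mu_le i y ys.
  move: big_mu'; rewrite (bigD1 i) //= [X in X + _ = _](bigD1 i) //=.
  have : \sum_(j in C | j != i) mu j <= \sum_(j in C | j != i) val x j.
    by apply: leq_sum => j _; exact: mu_le.
  rewrite /=; move: (\sum_(j in C | j != i) mu j) (\sum_(j in C | j != i) _).
  by move: (\sum_(_ < _ | _) _) => *; lia.
- by move=> _ i /imsetP[x xs ->]; rewrite -cval => iC; exact: out.
Qed.

From mathcomp Require Import all_classical all_reals all_analysis.
Import Order.TTheory GRing.Theory Num.Theory.
Import numFieldNormedType.Exports.

Local Open Scope classical_set_scope.
Local Open Scope ring_scope.

(** * The fixed point theorems of Brouwer and Kakutani on the simplex *)

Lemma ball_rV {R : numFieldType} {m : nat} (x y : 'rV[R]_m) (e : R) : 0 < e ->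
  (forall i, `|x ord0 i - y ord0 i| < e) -> ball x e y.
Proof. by move=> e0 xy; split => // i j; rewrite ord1; exact: xy. Qed.

Lemma continuous_at_sum {R : realType} {T : topologicalType}
    {V : normedModType R} {J : Type} (r : seq J) (f : J -> T -> V) (x : T) :
  (forall j, {for x, continuous (f j)}) ->
  {for x, continuous (fun y => \sum_(j <- r) f j y)}.
Proof.
move=> fC.
by apply: (@cvg_big V J +%R 0 predT add_continuous T (nbhs x) r f (f^~ x)) => // j _; exact: fC.
Qed.

Section Simplex.
Context {R : realType} {n : nat}.
Implicit Types x y z : 'rV[R]_n.+1.

Definition simplex : set 'rV[R]_n.+1 :=
  [set x | (forall i, 0 <= x ord0 i) /\ \sum_i x ord0 i = 1].

Lemma simplex_le1 x i : simplex x -> x ord0 i <= 1.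
Proof.
move=> [x0 <-]; rewrite (bigD1 i) //= lerDl.
by apply: sumr_ge0 => j _; exact: x0.
Qed.

Lemma compact_simplex : compact simplex.
Proof.
have cptB : compact [set x : 'rV[R]_n.+1 | forall i, `[0, 1]%classic (x ord0 i)].
  by apply: (@rV_compact R n.+1 (fun=> `[0%R, 1%R]%classic)) => _; exact: segment_compact.
apply: subclosed_compact cptB _; last first.
  by move=> x xS i; rewrite /= in_itv /= simplex_le1 // andbT; case: xS.
have -> : simplex = (\bigcap_i ((fun x : 'rV[R]_n.+1 => x ord0 i) @^-1` [set t | 0 <= t])) `&`
    ((fun x : 'rV[R]_n.+1 => \sum_i x ord0 i) @^-1` [set 1]).
  by apply/seteqP; split => [x [x0 x1]|x [x0 x1]]; split => // i; [move=> _|]; exact: x0.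
apply: closedI.
  apply: closed_bigI => i _; apply: preimage_closed; last exact: closed_ge.
  by move=> x _; exact: coord_continuous.
apply: preimage_closed; last exact: closed_eq.
by move=> x _; apply: continuous_at_sum => i; exact: coord_continuous.
Qed.

(** Any point of a cell of a fine grid will do, a grid point being coloured by a coordinate that [f]
    does not decrease. A colour present in the cell comes from a point [z] within [e]; a coordinate
    whose colour is absent is at most [e]. *)
Lemma approx_brouwer (f : 'rV[R]_n.+1 -> 'rV[R]_n.+1) (e : R) :
  (forall x, simplex x -> simplex (f x)) -> 0 < e ->
  exists2 x, simplex x & forall i, x ord0 i <= e \/
    exists2 z, simplex z & ball x e z /\ z ord0 i <= f z ord0 i.
Proof.
move=> fS e0.
have [m] : exists m : nat, n.+1%:R / m.+1%:R < e.
  exists (Num.truncn (n.+1%:R / e)); rewrite ltr_pdivrMr // mulrC -ltr_pdivrMr //.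
  by rewrite truncnS_gt.
move=> me.
(* The numerators run from 0 to [m.+1], so the mesh is [1 / m.+1]. *)
pose pt (v : {ffun 'I_n.+1 -> 'I_m.+2}) : 'rV[R]_n.+1 :=
  \row_i ((v i : nat)%:R / m.+1%:R).
have pick_color x : simplex x -> exists i, x ord0 i <= f x ord0 i.
  move=> xS; apply: contrapT => /forallNP no.
  have : \sum_i f x ord0 i < \sum_i x ord0 i.
    apply: ltr_sum => [|i _]; last by rewrite ltNge; apply/negP; exact: no.
    by apply/hasP; exists ord0; rewrite // mem_index_enum.
  by rewrite (fS x xS).2 xS.2 ltxx.
(* Off the simplex there may be no such index, and the default [ord0] is taken; all points of [s]
   are on the simplex. *)
pose c v : 'I_n.+1 := xget ord0 [set i | pt v ord0 i <= f (pt v) ord0 i].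
have [s [/set0Pn[v vs] sums diam out]] := grid_cell c.
have ptS w : w \in s -> simplex (pt w).
  move=> ws; split => [i|]; first by rewrite mxE divr_ge0.
  under eq_bigr do rewrite mxE.
  by rewrite -mulr_suml -natr_sum sums // divff.
exists (pt v); first exact: ptS.
move=> i; have [|ni] := boolP (i \in (c @: s)%SET); last first.
  left; apply: ltW; apply: le_lt_trans me; rewrite mxE ler_pM2r ?invr_gt0 //.
  by rewrite ler_nat; exact: out vs ni.
move=> /imsetP[w ws iw]; right; exists (pt w); first exact: ptS.
split; last first.
  by have := xgetPex ord0 (pick_color _ (ptS _ ws)); rewrite -/(c w) -iw.
apply: ball_rV => // j; rewrite !mxE -mulrBl normrM [X in _ * X]gtr0_norm ?invr_gt0 //.
apply: le_lt_trans me; rewrite ler_pM2r ?invr_gt0 //.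
have near_nat v1 v2 : v1 \in s -> v2 \in s ->
    (v1 j : nat)%:R - (v2 j : nat)%:R <= n.+1%:R :> R.
  by move=> v1s v2s; rewrite lerBlDl -natrD ler_nat; exact: diam.
by rewrite ler_norml lerNl opprB !near_nat.
Qed.

(** Without a fixed point, the equal coordinate sums give at each point a coordinate that [f]
    strictly decreases. By compactness this holds on balls of one radius [e], with that coordinate
    above [e], against [approx_brouwer]. *)
Lemma brouwer_simplex (f : 'rV[R]_n.+1 -> 'rV[R]_n.+1) :
  (forall x, simplex x -> simplex (f x)) ->
  (forall x, simplex x -> {for x, continuous f}) ->
  exists2 x, simplex x & f x = x.
Proof.
move=> fS fC; apply: contrapT => nofix.
have drop x : simplex x -> exists i, f x ord0 i < x ord0 i.
  move=> xS; apply: contrapT => /forallNP no.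
  have le i : x ord0 i <= f x ord0 i by rewrite leNgt; apply/negP; exact: no.
  apply: nofix; exists x => //; apply/rowP => i; apply/eqP.
  have := (fS x xS).2; rewrite -xS.2 => /eqP.
  rewrite -subr_eq0 -sumrB psumr_eq0; last by move=> j _; rewrite subr_ge0.
  by move/allP => /(_ i (mem_index_enum _)); rewrite subr_eq0.
pose P (e : R) x := exists i, e < x ord0 i /\
  forall z, simplex z -> ball x e z -> f z ord0 i < z ord0 i.
have : \forall e \near 0^'+, simplex `<=` P e.
  have /compact_near_coveringP/near_covering_withinP := compact_simplex; apply.
  move=> x xS; have [i fxi] := drop x xS.
  have xi0 : 0 < x ord0 i by apply: le_lt_trans fxi; exact: (fS x xS).1.
  have near_lt : \forall z \near x, f z ord0 i < z ord0 i.
    have cvg : {for x, continuous (fun z => z ord0 i - f z ord0 i)}.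
      apply: continuousB; first exact: coord_continuous.
      apply: (@continuous_comp _ _ _ f (fun y : 'rV[R]_n.+1 => y ord0 i)); first exact: fC.
      exact: coord_continuous.
    near=> z; rewrite -subr_gt0; near: z.
    by apply: (cvgr_gt _ cvg); rewrite subr_gt0.
  have near_gt : \forall z \near x, x ord0 i / 2 < (z : 'rV[R]_n.+1) ord0 i.
    apply: (@cvgr_gt R _ (nbhs x) _ (fun z : 'rV[R]_n.+1 => z ord0 i) (x ord0 i)).
      exact: coord_continuous.
    by lra.
  have /nbhs_ballP[d /= d0 dlt] := near_lt.
  near=> x' e => /= x'S; exists i; split.
    apply: (@lt_trans _ _ (x ord0 i / 2)); last by near: x'.
    by near: e; apply: nbhs_right_lt; rewrite divr_gt0.
  move=> z zS x'z; apply: dlt; apply: (@ball_split _ _ x').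
    by near: x'; apply: nbhsx_ballx; rewrite divr_gt0.
  apply: le_ball x'z; apply: ltW.
  by near: e; apply: nbhs_right_lt; rewrite divr_gt0.
move=> near0; near (0 : R)^'+ => e.
have e0 : 0 < e by near: e; exact: nbhs_right_gt.
have [x xS xe] := approx_brouwer fS e0.
have [i [ex bi]] : P e x by exact: (near near0 e).
case: (xe i) => [|[z zS [xz]]]; first by rewrite leNgt ex.
by rewrite leNgt bi.
Unshelve. all: by end_near. Qed.

End Simplex.

(** Replaces the bundled scalars [{i01 R}] of [convex_set] by plain inequalities. *)
Lemma convex_setP {R : realType} {E : lmodType R} (A : set E) :
  convex_set A <-> (forall (x y : E) (t : R), 0 <= t -> t <= 1 ->
    A x -> A y -> A (t *: x + (1 - t) *: y)).
Proof.
split => [cA x y t t0 t1 Ax Ay|cA x y t xA yA].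
  have t01 : Itv.spec (@Itv.num_sem R) (Itv.Real `[0%Z, 1%Z]) t.
    by rewrite /Itv.spec/= /Itv.num_sem/= num_real in_itv /= t0 t1.
  have /set_mem := cA x y (Itv.mk t01 : {i01 R}) (mem_set Ax) (mem_set Ay).
  by [].
apply: mem_set; have := cA x y t%:num (ge0 t) (le1 t) (set_mem xA) (set_mem yA).
exact.
Qed.

(** Induction on [r], the head getting weight [w a / (w a + W)]; zero weights are treated apart
    because the tail is divided by [W]. Membership is asked only at positive weights, which suits a
    partition of unity with small supports. *)
Lemma convex_weighted_mean {R : realType} {E : lmodType R} {I : eqType}
    (A : set E) (r : seq I) (w : I -> R) (p : I -> E) :
  convex_set A -> (forall i, i \in r -> 0 <= w i) ->
  (forall i, i \in r -> 0 < w i -> A (p i)) ->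
  0 < \sum_(i <- r) w i ->
  A ((\sum_(i <- r) w i)^-1 *: \sum_(i <- r) w i *: p i).
Proof.
move=> /convex_setP cA; elim: r => [|a r ih] w0 pA.
  by rewrite big_nil ltxx.
have w0' i : i \in r -> 0 <= w i by move=> ir; apply: w0; rewrite inE ir orbT.
have pA' i : i \in r -> 0 < w i -> A (p i) by move=> ir; apply: pA; rewrite inE ir orbT.
rewrite !big_cons; set W := \sum_(i <- r) w i; set S := \sum_(i <- r) _.
have W0 : 0 <= W by rewrite /W big_seq; apply: sumr_ge0 => i; exact: w0'.
have wa0 : 0 <= w a by apply: w0; rewrite inE eqxx.
move=> tot0; have [Weq|Wneq] := eqVneq W 0.
  have -> : S = 0.
    rewrite /S big_seq big1 // => i ir; suff -> : w i = 0 by rewrite scale0r.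
    move/eqP: Weq; rewrite /W big_seq psumr_eq0; last exact: w0'.
    by move=> /allP /(_ i ir); rewrite ir => /eqP.
  rewrite Weq !addr0 in tot0 *; rewrite scalerA mulVf ?gt_eqF // scale1r.
  by apply: pA tot0; rewrite inE eqxx.
have Wpos : 0 < W by rewrite lt_neqAle eq_sym Wneq.
have [wa|wa] := eqVneq (w a) 0.
  by rewrite wa scale0r !add0r; exact: ih.
have wapos : 0 < w a by rewrite lt_neqAle eq_sym wa.
have -> : (w a + W)^-1 *: (w a *: p a + S) =
    (w a / (w a + W)) *: p a + (1 - w a / (w a + W)) *: (W^-1 *: S).
  rewrite scalerDr !scalerA; congr (_ *: _ + _ *: _); first by rewrite mulrC.
  by field; rewrite !gt_eqF.
apply: cA.
- by rewrite divr_ge0 ?addr_ge0.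
- by rewrite ler_pdivrMr // mul1r lerDl.
- by apply: pA wapos; rewrite inE eqxx.
- exact: ih.
Qed.

Section Kakutani.
Context {R : realType} {n : nat}.
Local Notation E := 'rV[R]_n.+1.
Implicit Types (x y z : E) (F : E -> set E).

Lemma convex_simplex : convex_set (@simplex R n).
Proof.
apply/convex_setP => x y t t0 t1 [x0 x1] [y0 y1]; split => [i|].
  by rewrite !mxE addr_ge0 // mulr_ge0 // subr_ge0.
under eq_bigr do rewrite !mxE.
by rewrite big_split /= -!mulr_sumr x1 y1 !mulr1 addrC subrK.
Qed.

Lemma finite_net (K : set E) (e : R) : compact K -> 0 < e ->
  exists2 s : seq E, (forall v, v \in s -> K v) &
    forall x, K x -> exists2 v, v \in s & ball v e x.
Proof.
rewrite compact_cover => cK e0.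
have [|x Kx|D DK cov] := cK _ K (fun v : E => ball v e).
- by move=> v _; exact: ball_open.
- by exists x => //; exact: ballxx.
exists (finmap.enum_fset D); first by move=> v /DK /set_mem.
by move=> x /cov[v vD xv]; exists v.
Qed.

(** Selections at the points of a finite [e]-net are averaged by a partition of unity into a
    continuous [f]. A fixed point [x] is a convex combination of points of [F v] with [v] within [e]
    of [x], which the quantification over [A] expresses. *)
Lemma approx_kakutani F (e : R) :
  (forall x, simplex x -> F x !=set0) ->
  (forall x, simplex x -> F x `<=` simplex) -> 0 < e ->
  exists2 x, simplex x & forall A : set E, convex_set A ->
    (forall v, simplex v -> ball x e v -> F v `<=` A) -> A x.
Proof.
move=> F0 FS e0.
have [s sS net] := finite_net compact_simplex e0.
pose sel v := xget 0 (F v).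
have selF v : v \in s -> F v (sel v) by move=> vs; apply: xgetPex; apply: F0; exact: sS.
(* A tent function, positive exactly on the ball of radius [e] about [v]. *)
pose w v x := Num.max 0 (e - `|v - x|).
have w0 v x : 0 <= w v x by rewrite le_max lexx.
have w_ball v x : 0 < w v x -> ball x e v.
  by rewrite lt_max ltxx /= subr_gt0 distrC -ball_normE.
have wC v x : {for x, continuous (w v)}.
  apply: (@continuous_max R E (fun=> 0) (fun x => e - `|v - x|)); first exact: cst_continuous.
  apply: (@continuousB R R^o E (fun=> e) (fun x => `|v - x|)); first exact: cst_continuous.
  apply: (@continuous_comp E E R (fun x => v - x) (fun y => `|y|)); last exact: norm_continuous.
  by apply: (@continuousB R E E (fun=> v) id); [exact: cst_continuous|move=> ?; exact].
pose W x := \sum_(v <- s) w v x.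
have Wpos x : simplex x -> 0 < W x.
  move=> /net[v vs vx]; rewrite /W lt_neqAle eq_sym sumr_ge0 // andbT.
  rewrite psumr_neq0 //; apply/hasP; exists v => //=.
  by move: vx; rewrite -ball_normE /= => vx; rewrite lt_max subr_gt0 vx orbT.
pose f x := (W x)^-1 *: \sum_(v <- s) w v x *: sel v.
have fA x (A : set E) : simplex x -> convex_set A ->
    (forall v, simplex v -> ball x e v -> F v `<=` A) -> A (f x).
  move=> xS cA FA; apply: convex_weighted_mean => //; last exact: Wpos.
  by move=> v vs /w_ball xv; apply: (FA v) => //; [exact: sS|exact: selF].
have [x xS fx] : exists2 x, simplex x & f x = x.
  apply: brouwer_simplex => x xS.
    by apply: fA => // [|v vS _]; [exact: convex_simplex|exact: FS].
  apply: (@continuousZ _ _ _ (fun x => (W x)^-1)).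
    apply: continuousV; first by rewrite gt_eqF // Wpos.
    by apply: continuous_at_sum => v; exact: wC.
  apply: continuous_at_sum => v; apply: (@continuousZ _ _ _ (w v)); first exact: wC.
  exact: cst_continuous.
by exists x => // A cA FA; rewrite -fx; exact: fA.
Qed.

(** Without a fixed point, a convex neighbourhood [A] of [F x] stays away from [x], and it contains
    [F v] for [v] near [x], since a closed graph in a compact set gives upper semicontinuity.
    Compactness makes the radius uniform, against [approx_kakutani]. *)
Lemma kakutani_simplex F :
  (forall x, simplex x -> F x !=set0) ->
  (forall x, simplex x -> F x `<=` simplex) ->
  (forall x, simplex x -> convex_set (F x)) ->
  (forall x y, simplex x -> simplex y -> ~ F x y ->
    \forall y' \near y & x' \near x, simplex x' -> ~ F x' y') ->
  exists2 x, simplex x & F x x.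
Proof.
move=> F0 FS Fcvx Fclosed; apply: contrapT => nofix.
pose P (e : R) x := exists A : set E, [/\ convex_set A, ~ A x &
  forall v, simplex v -> ball x e v -> F v `<=` A].
have : \forall e \near 0^'+, simplex `<=` P e.
  have /compact_near_coveringP/near_covering_withinP := @compact_simplex R n; apply.
  move=> x xS.
  have nFx : ~ F x x by move=> Fxx; apply: nofix; exists x.
  have /nbhs_ballP[d /= d0 dF] : \forall y \near x, ~ F x y.
    have [[U V] /= [Ux Vx] UV] := Fclosed x x xS xS nFx.
    apply: filterS Ux => y Uy; apply: (UV (y, x)) => //; split => //=.
    exact: nbhs_singleton.
  pose A : set E := [set a | exists2 b, F x b & `|a - b| < d / 2].
  have cA : convex_set A.
    apply/convex_setP => a a' t t0 t1 [b Fb ab] [b' Fb' ab'].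
    exists (t *: b + (1 - t) *: b').
      by have /convex_setP := Fcvx x xS; exact.
    rewrite opprD addrACA -!scalerBr; apply: le_lt_trans (ler_normD _ _) _.
    rewrite !normrZ !ger0_norm ?subr_ge0 //.
    (* Strictness is drawn from the first term, hence the separate case [t = 0]. *)
    have [->|tn0] := eqVneq t 0; first by rewrite mul0r add0r subr0 mul1r.
    have tpos : 0 < t by rewrite lt_neqAle eq_sym tn0.
    have : t * `|a - b| < t * (d / 2) by rewrite ltr_pM2l.
    have : (1 - t) * `|a' - b'| <= (1 - t) * (d / 2) by rewrite ler_wpM2l ?subr_ge0 // ltW.
    lra.
  have FA : \forall v \near x, simplex v -> F v `<=` A.
    pose Q v y := simplex v -> F v y -> A y.
    have : \forall v \near x, simplex `<=` Q v.
      have /compact_near_coveringP covering := @compact_simplex R n.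
      apply: (covering _ (nbhs x) Q).
      move=> y yS.
      (* Points close to [F x] are in [A]; near any other [y] the closed graph keeps [F v] away. *)
      have [Fy|nFy] := pselect (F x y).
        near=> y' v => /= _ _; exists y => //.
        suff : ball y (d / 2) y' by rewrite -ball_normE /= distrC.
        by near: y'; apply: nbhsx_ballx; rewrite divr_gt0.
      have := Fclosed x y xS yS nFy; apply: filterS => -[y' v] /= h vS Fv.
      by case: (h vS).
    by apply: filterS => v h vS y Fv; exact: (h y (FS v vS y Fv)).
  have /nbhs_ballP[r /= r0 rFA] := FA.
  near=> x' e => /= x'S; exists A; split => //.
    move=> [b Fb x'b]; apply: (dF b) => //; apply: (@ball_split _ _ x').
      by near: x'; apply: nbhsx_ballx; rewrite divr_gt0.
    by rewrite -ball_normE.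
  move=> v vS x'v; apply: rFA => //; apply: (@ball_split _ _ x').
    by near: x'; apply: nbhsx_ballx; rewrite divr_gt0.
  apply: le_ball x'v; apply: ltW.
  by near: e; apply: nbhs_right_lt; rewrite divr_gt0.
move=> near0; near (0 : R)^'+ => e.
have e0 : 0 < e by near: e; exact: nbhs_right_gt.
have [x xS xA] := approx_kakutani F0 FS e0.
have [A [cA nAx FA]] : P e x by exact: (near near0 e).
by apply: nAx; exact: xA.
Unshelve. all: by end_near. Qed.

End Kakutani.

(** * Pseudo-continuous functions and argmin maps *)

Lemma cvg_prod_topology {S : Type} {F : set_system S} {FF : Filter F}
    {I : Type} {T : I -> topologicalType} (g : S -> prod_topology T)
    (l : prod_topology T) :
  (forall i, g s i @[s --> F] --> l i) -> g @ F --> l.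
Proof.
move=> gl; apply/cvg_sup => i U [V] [[W] oW <-] Wl WU.
by apply: (filterS WU); apply: gl; exact: open_nbhs_nbhs.
Qed.

Lemma continuous_at_ball {R : realType} {S : topologicalType}
    {V : normedModType R} (g : S -> V) (s : S) :
  (forall e, 0 < e -> \forall s' \near s, ball (g s) e (g s')) ->
  {for s, continuous g}.
Proof. by move=> h; apply/cvg_ballP. Qed.

Lemma continuous_row {R : realType} {S : topologicalType} {m : nat}
    (g : S -> 'rV[R]_m) (s : S) :
  (forall i, {for s, continuous (fun s' => g s' ord0 i)}) ->
  {for s, continuous g}.
Proof.
move=> gC; apply: continuous_at_ball => e e0.
have : \forall s' \near s, forall i, `|g s ord0 i - g s' ord0 i| < e.
  by apply: filter_forall => i; have /cvgrPdist_lt := gC i; apply.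
by apply: filterS => s' ?; exact: ball_rV.
Qed.

Lemma coord_le_norm {R : realType} {m : nat} (x : 'rV[R]_m) i :
  `|x ord0 i| <= `|x|.
Proof.
rewrite [leRHS]/Num.norm /= mx_normrE.
exact: (le_bigmax _ (fun ij => `|x ij.1 ij.2|) (ord0, i)).
Qed.

Section PseudoContinuous.
Context {R : realType}.

Lemma lower_pseudo_continuousP {T : topologicalType} (f : T -> R) :
  lower_pseudo_continuous f <->
  (forall x y, f y < f x -> \forall x' \near x, f y < f x').
Proof.
split => h x y; first by rewrite -ltrN2 => /h; apply: filterS => x'; rewrite ltrN2.
by rewrite ltrN2 => /h; apply: filterS => x'; rewrite ltrN2.
Qed.

Lemma pseudo_continuous_comp {S T : topologicalType} (f : T -> R) (g : S -> T) :
  pseudo_continuous f -> continuous g -> pseudo_continuous (f \o g).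
Proof.
move=> [fu fl] gC; split => x y fxy; first exact: (gC x _ (fu _ _ fxy)).
exact: (gC x _ (fl _ _ fxy)).
Qed.

Lemma continuous_lower_pseudo {T : topologicalType} (f : T -> R) :
  continuous f -> lower_pseudo_continuous f.
Proof.
move=> fC; apply/lower_pseudo_continuousP => x y fyx.
by apply: (@cvgr_gt R _ (nbhs x) _ f (f x)) => //; exact: fC.
Qed.

(** Lower pseudo-continuity makes the sublevel sets at attained values closed. They form a chain, so
    a cluster point of the filter they generate in [A] lies in all of them. *)
Lemma lower_pseudo_argmin {T : topologicalType} (f : T -> R) (A : set T) :
  lower_pseudo_continuous f -> compact A -> A !=set0 ->
  exists2 x, A x & forall y, A y -> f x <= f y.
Proof.
move=> /lower_pseudo_continuousP fl cA [a Aa].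
pose F := filter_from A (fun w => [set x | A x /\ f x <= f w]).
have FF : ProperFilter F.
  apply: filter_from_proper => [|w Aw]; last by exists w; split.
  apply: filter_from_filter => [|w w' Aw Aw']; first by exists a.
  case: (leP (f w) (f w')) => ww'; [exists w => // | exists w' => //] => x [Ax xw].
    by split => //; split => //; exact: le_trans xw ww'.
  by split => //; split => //; apply: le_trans xw (ltW ww').
have FA : F A by exists a => // x [].
have [x [Ax clx]] := cA F FF FA.
exists x => // y Ay; rewrite leNgt; apply/negP => yx.
have Fy : F [set x | A x /\ f x <= f y] by exists y.
have [z [[_ zy] /=]] := clx _ _ Fy (fl _ _ yx).
by rewrite ltNge zy.
Qed.

(* Berge's maximum theorem for the argmin of f(y, .) over Z(y); when no value of
   f lies strictly between f(y, w0) < f(y, w), pseudo-continuity still gives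
   f > f(y, w0) near (y, w) and f <= f(y, w0) near (y, w0). *)
Lemma argmin_closed_graph {T : topologicalType} {W : normedModType R}
    (Z : T -> set W) (f : T * W -> R) (y : T) (w : W) :
  pseudo_continuous f -> closed (Z y) -> setmap_lsc_at Z y -> setmap_usc_at Z y ->
  ~ (Z y w /\ forall u, Z y u -> f (y, w) <= f (y, u)) ->
  \forall w' \near w & y' \near y,
    ~ (Z y' w' /\ forall u, Z y' u -> f (y', w') <= f (y', u)).
Proof.
move=> [fu /lower_pseudo_continuousP fl] Zcl Zl Zu nB.
have [Zw|nZw] := pselect (Z y w); last first.
  have /nbhs_ballP[d /= d0 dZ] : \forall w' \near w, ~ Z y w'.
    by apply: open_nbhs_nbhs; split; [exact: closed_openC|].
  (* Upper semicontinuity keeps [Z y'] within [d / 2] of [Z y], so it misses every [w'] close to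
     [w]. *)
  pose V := \bigcup_(b in Z y) ball b (d / 2).
  have oV : open V by apply: bigcup_open => b _; apply: ball_open; rewrite divr_gt0.
  have ZV : Z y `<=` V by move=> b Zb; exists b => //; apply: ballxx; rewrite divr_gt0.
  have nearV := Zu V oV ZV.
  near=> w' y' => /= -[Zw' _].
  have [b Zb bw'] : V w' by apply: (near nearV y').
  apply: (dZ b) => //; apply: (@ball_split _ _ w'); last exact: ball_sym.
  by near: w'; apply: nbhsx_ballx; rewrite divr_gt0.
have [w0 Zw0 w0w] : exists2 u, Z y u & f (y, u) < f (y, w).
  apply: contrapT => no; apply: nB; split => // u Zu'.
  by rewrite leNgt; apply/negP => uw; apply: no; exists u.
have [N0 [N1 [nN0 nN1 sep]]] : exists N0 N1, [/\ nbhs (y, w0) N0,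
    nbhs (y, w) N1 & forall p q, N0 p -> N1 q -> f p < f q].
  have [[z [w0z zw]]|no] := pselect (exists z, f (y, w0) < f z /\ f z < f (y, w)).
    exists [set p | f p < f z], [set q | f z < f q]; split; [exact: fu|exact: fl|].
    by move=> p q /= pz zq; exact: lt_trans pz zq.
  exists [set p | f p < f (y, w)], [set q | f (y, w0) < f q].
  split; [exact: fu|exact: fl|] => p q /= pw w0q.
  apply: le_lt_trans w0q; rewrite leNgt; apply/negP => w0p.
  by apply: no; exists p.
have [[U0 V0] /= [yU0 wV0] UV0] := nN0.
have [[U1 V1] /= [yU1 wV1] UV1] := nN1.
(* Lower semicontinuity supplies a competitor [u] in [Z y'] near [w0], which beats [w']. *)
have nearZ : \forall y' \near y, Z y' `&` V0^° !=set0.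
  apply: Zl; first exact: open_interior.
  by exists w0; split => //; exact: nbhs_singleton (nbhs_interior wV0).
near=> w' y' => /= -[Zw' /(_ _ _)].
have [u [Zu' V0u]] : Z y' `&` V0^° !=set0 by apply: (near nearZ y').
move=> /(_ u Zu'); rewrite leNgt sep //.
  apply: (UV0 (y', u)); split => /=; first by near: y'.
  exact: interior_subset.
by apply: (UV1 (y', w')); split => /=; [near: y'|near: w'].
Unshelve. all: by end_near. Qed.

End PseudoContinuous.

(** * Euclidean projection onto a closed convex set *)

Section EuclideanProjection.
Context {R : realType} {m : nat}.
Implicit Types (x y z : 'rV[R]_m) (K : set 'rV[R]_m).

Definition sqdist x y : R := \sum_i (x ord0 i - y ord0 i) ^+ 2.

Lemma sqdist_continuous z : continuous (sqdist z).
Proof.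
move=> x; apply: continuous_at_sum => i.
apply: (@continuous_comp _ _ _ (fun x : 'rV[R]_m => z ord0 i - x ord0 i) (fun t => t ^+ 2)).
  apply: (@continuousB R R^o _ (fun=> z ord0 i)); first exact: cst_continuous.
  exact: coord_continuous.
exact: exprn_continuous.
Qed.

Lemma sqdistxx x : sqdist x x = 0.
Proof. by rewrite /sqdist big1 // => i _; rewrite subrr expr0n. Qed.

Lemma coord_le_sqdist x y i : (x ord0 i - y ord0 i) ^+ 2 <= sqdist x y.
Proof.
rewrite /sqdist (bigD1 i) //= lerDl; apply: sumr_ge0 => j _; exact: sqr_ge0.
Qed.

Lemma nearest_point K z : closed K -> K !=set0 ->
  exists2 p, K p & forall x, K x -> sqdist z p <= sqdist z x.
Proof.
move=> clK [a Ka]; pose c := sqdist z a.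
have c0 : 0 <= c by apply: sumr_ge0 => i _; exact: sqr_ge0.
pose K' := K `&` [set x | sqdist z x <= c].
have cK' : compact K'.
  (* The half-width [c + 1] avoids a square root: [t ^+ 2 <= c] implies that [t] is at most [c + 1]
     in absolute value. *)
  have cB : compact [set x : 'rV[R]_m | forall i,
      `[z ord0 i - (c + 1), z ord0 i + (c + 1)]%classic (x ord0 i)].
    apply: (@rV_compact R m (fun i => `[z ord0 i - (c + 1), z ord0 i + (c + 1)]%classic)).
    by move=> i; exact: segment_compact.
  apply: subclosed_compact cB _.
    apply: closedI => //; apply: (@preimage_closed _ _ (sqdist z) [set t | t <= c]).
      by move=> x _; exact: sqdist_continuous.
    exact: closed_le.
  move=> x [_ /= zx] i; have := le_trans (coord_le_sqdist z x i) zx.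
  rewrite in_itv /= => sq; have : `|z ord0 i - x ord0 i| <= c + 1.
    by rewrite -ler_sqr ?nnegrE ?addr_ge0 // real_normK ?num_real //; nra.
  by rewrite ler_norml => /andP[h1 h2]; apply/andP; split; lra.
have [|p [Kp pc] pmin] := lower_pseudo_argmin
  (continuous_lower_pseudo (sqdist_continuous (z := z))) cK'.
  by exists a; split => //=; exact: lexx.
exists p => // x Kx; have [xc|/ltW cx] := leP (sqdist z x) c; first exact: pmin.
exact: le_trans pc cx.
Qed.

(** Moving from [p] towards [w] by [t] changes the squared distance by [t * (t * q - 2 * s)]. If
    [s > 0], the choice [t = s / (s + q)] gives [t * q < s], so the distance would decrease. *)
Lemma variational_inequality K z p w : convex_set K -> K p ->
  (forall x, K x -> sqdist z p <= sqdist z x) -> K w ->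
  \sum_i (z ord0 i - p ord0 i) * (w ord0 i - p ord0 i) <= 0.
Proof.
move=> /convex_setP cK Kp pmin Kw; set s := \sum_i _.
rewrite leNgt; apply/negP => s0.
pose q := sqdist w p.
have q0 : 0 <= q by apply: sumr_ge0 => i _; exact: sqr_ge0.
pose t := s / (s + q).
have sq0 : 0 < s + q by rewrite ltr_wpDr.
have t0 : 0 < t by rewrite divr_gt0.
have t1 : t <= 1 by rewrite ler_pdivrMr // mul1r lerDl.
have := pmin _ (cK w p t (ltW t0) t1 Kw Kp).
have -> : sqdist z (t *: w + (1 - t) *: p) = sqdist z p - 2 * t * s + t ^+ 2 * q.
  rewrite /sqdist /s /q /sqdist !mulr_sumr -sumrB -big_split /=.
  by apply: eq_bigr => i _; rewrite !mxE; ring.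
rewrite -subr_ge0.
have -> : sqdist z p - 2 * t * s + t ^+ 2 * q - sqdist z p = t * (t * q - 2 * s) by ring.
rewrite pmulr_rge0 // subr_ge0 => le.
have : t * (s + q) = s by rewrite /t divfK // gt_eqF.
nra.
Qed.

(** The two variational inequalities are added; what remains is the squared norm of
    [(p - p') - (z - z')]. *)
Lemma projection_nonexpansive K z z' p p' : convex_set K -> K p -> K p' ->
  (forall x, K x -> sqdist z p <= sqdist z x) ->
  (forall x, K x -> sqdist z' p' <= sqdist z' x) ->
  sqdist p p' <= sqdist z z'.
Proof.
move=> cK Kp Kp' pmin pmin'.
have v1 := variational_inequality cK Kp pmin Kp'.
have v2 := variational_inequality cK Kp' pmin' Kp.
rewrite -subr_le0; apply: le_trans (_ : 2 * (\sum_i (z ord0 i - p ord0 i) * (p' ord0 i - p ord0 i)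
   + \sum_i (z' ord0 i - p' ord0 i) * (p ord0 i - p' ord0 i)) <= 0); last by lra.
rewrite /sqdist -sumrB -big_split mulr_sumr; apply: ler_sum => i _ /=.
rewrite -subr_ge0; set d := (X in 0 <= X).
have -> : d = ((p ord0 i - p' ord0 i) - (z ord0 i - z' ord0 i)) ^+ 2 by rewrite /d; ring.
exact: sqr_ge0.
Qed.

Lemma continuous_projection K : closed K -> convex_set K -> K !=set0 ->
  exists2 P : 'rV[R]_m -> 'rV[R]_m, continuous P &
    forall z, K (P z) /\ forall x, K x -> sqdist z (P z) <= sqdist z x.
Proof.
move=> clK cK K0.
have /choice[P PP] : forall z, exists p, K p /\ forall x, K x -> sqdist z p <= sqdist z x.
  by move=> z; have [p Kp pmin] := nearest_point z clK K0; exists p.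
exists P => // z; apply: continuous_at_ball => e e0.
have e20 : sqdist z z < e ^+ 2 by rewrite sqdistxx exprn_gt0.
have : \forall z' \near z, sqdist z z' < e ^+ 2.
  by apply: (@cvgr_lt R _ (nbhs z) _ (sqdist z) (sqdist z z)) => //; exact: sqdist_continuous.
apply: filterS => z' zz'; apply: ball_rV => // i.
rewrite -ltr_sqr ?nnegrE ?(ltW e0) // real_normK ?num_real //.
apply: le_lt_trans zz'; apply: le_trans (coord_le_sqdist _ _ _) _.
by apply: projection_nonexpansive (PP z).1 (PP z').1 (PP z).2 (PP z').2.
Qed.

End EuclideanProjection.

(** * Existence of projected solutions *)

(** Since [g] takes its values in [D], subspace neighbourhoods pull back along it. With [g] the
    projection onto [K], the maps become continuous on all profiles. *)
Lemma setmap_continuous_on_comp {S X Y : topologicalType} (D : set X)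
    (T : X -> set Y) (g : S -> X) :
  setmap_continuous_on D T -> continuous g -> (forall s, D (g s)) ->
  setmap_continuous (T \o g).
Proof.
move=> TC gC gD s; have [Tl Tu] := TC (g s).
have pull Q : nbhs (g s : subspace D) Q -> \forall s' \near s, Q (g s').
  rewrite /= /nbhs /= -(nbhs_subspace_in (gD s)) => nQ.
  by apply: (@filterS _ (nbhs s) _ _ _ _ (gC s _ nQ)) => s'; apply; exact: gD.
by split => V oV /= h; [exact: pull _ (Tl V oV h) | exact: pull _ (Tu V oV h)].
Qed.

(** * Profiles and their parametrisation by a simplex *)

Section Profiles.
Context {R : realType} {N : finType} {n_ : N -> nat}.
Local Notation profile := (profile R n_).

Lemma continuous_coord nu : continuous (fun x : profile => x nu).
Proof. exact: (@proj_continuous N (fun nu : N => 'rV[R]_(n_ nu)) nu). Qed.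

Lemma continuous_profile {S : topologicalType} (g : S -> profile) :
  (forall nu, continuous (fun s => g s nu)) -> continuous g.
Proof.
move=> gC s.
by apply: (@cvg_prod_topology _ (nbhs s) _ _ (fun nu : N => 'rV[R]_(n_ nu)) g) => nu; exact: gC.
Qed.

Lemma continuous_replace nu :
  continuous (fun p : profile * 'rV[R]_(n_ nu) => replace p.1 p.2).
Proof.
apply: continuous_profile => mu.
have [<-|numu] := eqVneq nu mu.
  have -> : (fun p : profile * 'rV[R]_(n_ nu) => replace p.1 p.2 nu) = snd.
    by apply/funext => p; rewrite /replace dfwithin.
  by move=> p; exact: cvg_snd.
have -> : (fun p : profile * 'rV[R]_(n_ nu) => replace p.1 p.2 mu) =
    (fun x : profile => x mu) \o fst.
  by apply/funext => p; rewrite /replace dfwithout.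
move=> p; apply: continuous_comp; first exact: cvg_fst.
exact: continuous_coord.
Qed.

Lemma replace_id (x : profile) nu : replace x (x nu) = x.
Proof.
by apply/functional_extensionality_dep => mu; rewrite /replace; case: dfwithP.
Qed.

Local Notation coord := {nu : N & 'I_(n_ nu)}.
Local Notation E := 'rV[R]_(#|{: coord}|).+1.

(* Coordinate 0 of the simplex is the slack; the others are rescaled from [0, 1]
   so that every profile with coordinates in [-M, M] is reached. *)
Definition simplex_profile (L M : R) (s : E) : profile :=
  fun nu => \row_i (L * s ord0 (lift ord0 (enum_rank (Tagged (fun nu => 'I_(n_ nu)) i))) - M).

Lemma continuous_simplex_profile L M : continuous (simplex_profile L M).
Proof.
apply: continuous_profile => nu s; apply: continuous_row => i.
pose j := lift ord0 (enum_rank (Tagged (fun nu => 'I_(n_ nu)) i)).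
have -> : (fun s' => simplex_profile L M s' nu ord0 i) = (fun s' => L * s' ord0 j - M).
  by apply/funext => s'; rewrite mxE.
apply: (@continuousB R R^o _ (fun s' : E => L * s' ord0 j)); last exact: cst_continuous.
apply: (@continuousM _ _ (fun=> L)); first exact: cst_continuous.
exact: coord_continuous.
Qed.

Lemma simplex_profile_conv L M (s t : E) (a : R) nu :
  simplex_profile L M (a *: s + (1 - a) *: t) nu =
  a *: simplex_profile L M s nu + (1 - a) *: simplex_profile L M t nu.
Proof. by apply/rowP => i; rewrite !mxE; ring. Qed.

(** The lower bound on [L] is what makes the slack coordinate non-negative: each of the other
    coordinates is at most [2 * M / L]. *)
Lemma simplex_profile_onto (L M : R) (w : profile) : 0 < L ->
  2 * M * #|{: coord}|%:R <= L ->
  (forall nu i, `|w nu ord0 i| <= M) ->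
  exists2 s, simplex s & simplex_profile L M s = w.
Proof.
move=> L0 LM wM.
pose v (k : 'I_#|{: coord}|) := w (tag (enum_val k)) ord0 (tagged (enum_val k)).
have vM k : - M <= v k <= M by rewrite -ler_norml; exact: wM.
pose S := \sum_k (v k + M) / L.
pose s : E := \row_j if unlift ord0 j is Some k then (v k + M) / L else 1 - S.
have sL k : s ord0 (lift ord0 k) = (v k + M) / L by rewrite mxE liftK.
have s0 : s ord0 ord0 = 1 - S by rewrite mxE unlift_none.
exists s; last first.
  apply/functional_extensionality_dep => nu; apply/rowP => i.
  rewrite mxE sL mulrC divfK ?gt_eqF // addrK /v enum_rankK.
  by [].
split=> [j|]; last first.
  by rewrite big_ord_recl s0; under eq_bigr do rewrite sL; rewrite -/S subrK.
case: (unliftP ord0 j) => [k ->|->].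
  by rewrite sL divr_ge0 ?(ltW L0) //; have := vM k; lra.
rewrite s0 subr_ge0 /S -mulr_suml ler_pdivrMr // mul1r.
apply: le_trans LM; apply: (@le_trans _ _ (\sum_(k < #|{: coord}|) (2 * M))).
  by apply: ler_sum => k _; have := vM k; lra.
by rewrite sumr_const card_ord mulr_natr.
Qed.

End Profiles.

Theorem theorem3p5 (R : realType) (N : finType) (n_ : N -> nat)
    (K_ : forall nu : N, set 'rV[R]_(n_ nu))
    (X_ : forall nu : N, profile R n_ -> set 'rV[R]_(n_ nu))
    (theta : N -> profile R n_ -> R)
    (N_nonempty : (0 < #|N|)%N)
    (K_convex : forall nu : N, convex_set (K_ nu))
    (K_closed : forall nu : N, closed (K_ nu))
    (K_nonempty : forall nu : N, K_ nu !=set0)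
    (X_continuous : forall nu : N,
       setmap_continuous_on (prod_set K_) (X_ nu))
    (X_convex : forall (nu : N) (x : profile R n_),
       prod_set K_ x -> convex_set (X_ nu x))
    (X_compact : forall (nu : N) (x : profile R n_),
       prod_set K_ x -> compact (X_ nu x))
    (X_nonempty : forall (nu : N) (x : profile R n_),
       prod_set K_ x -> X_ nu x !=set0)
    (X_bounded : forall nu : N,
       bounded_set (\bigcup_(x in prod_set K_) X_ nu x))
    (theta_pseudo_continuous : forall nu : N, pseudo_continuous (theta nu))
    (theta_quasiconvex : forall (nu : N) (x : profile R n_),
       quasiconvex (fun u : 'rV[R]_(n_ nu) => theta nu (replace x u))) :
  exists xhat yhat : profile R n_, projected_solution K_ X_ theta xhat yhat.
Proof.
pose pick nu := cid2 (continuous_projection (K_closed nu) (K_convex nu) (K_nonempty nu)).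
pose P (y : profile R n_) : profile R n_ := fun nu => s2val (pick nu) (y nu).
have P_nearest nu y : K_ nu (P y nu) /\
    forall x, K_ nu x -> sqdist (y nu) (P y nu) <= sqdist (y nu) x.
  exact: (s2valP' (pick nu) (y nu)).
have PK y : prod_set K_ (P y) by move=> nu; exact: (P_nearest nu y).1.
have PC : continuous P.
  apply: continuous_profile => nu y.
  apply: continuous_comp; first exact: continuous_coord.
  exact: (s2valP (pick nu)).
pose Z nu := X_ nu \o P.
have ZC nu : setmap_continuous (Z nu) by exact: setmap_continuous_on_comp.
pose f nu (p : profile R n_ * 'rV[R]_(n_ nu)) := theta nu (replace p.1 p.2).
have fpc nu : pseudo_continuous (f nu).
  exact: (pseudo_continuous_comp (theta_pseudo_continuous nu) (@continuous_replace _ _ _ nu)).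
(* Best responses to the other components of [y], with the feasible set taken at the projection
   [P y]. *)
pose B nu y w := Z nu y w /\ forall u, Z nu y u -> f nu (y, w) <= f nu (y, u).
have B_nonempty nu y : B nu y !=set0.
  have [_ /lower_pseudo_continuousP fl] := fpc nu.
  have [|||w Zw wmin] := @lower_pseudo_argmin R _ (fun w => f nu (y, w)) (Z nu y).
  - apply/lower_pseudo_continuousP => w u uw.
    have [[U V] /= [yU wV] UV] := fl _ _ uw.
    apply: filterS wV => w' Vw'; apply: (UV (y, w')); split => //=.
    exact: nbhs_singleton.
  - exact: X_compact.
  - exact: X_nonempty.
  by exists w.
have B_convex nu y : convex_set (B nu y).
  apply/convex_setP => w w' t t0 t1 [Zw wmin] [Zw' wmin']; split.
    by have /convex_setP := X_convex nu _ (PK y); apply.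
  move=> u Zu; apply: le_trans (theta_quasiconvex nu y w w' t t0 t1) _.
  by rewrite ge_max wmin // wmin'.
have [M M0 ZM] : exists2 M, 0 < M & forall nu y w i, Z nu y w -> `|w ord0 i| <= M.
  have nearM : \forall M \near +oo, forall nu,
      forall w, (\bigcup_(x in prod_set K_) X_ nu x) w -> `|w| <= M.
    by apply: filter_forall => nu; exact: X_bounded.
  near (+oo : set_system R) => M; exists M; first by near: M; exact: nbhs_pinfty_gt.
  move=> nu y w i Zw; apply: le_trans (coord_le_norm w i) _.
  have hM : forall nu, forall w, (\bigcup_(x in prod_set K_) X_ nu x) w -> `|w| <= M.
    by near: M.
  by apply: hM; exists (P y).
(* The successor keeps [L] positive even when there are no coordinates. *)
pose L := 2 * M * #|{: {nu : N & 'I_(n_ nu)}}|.+1%:R.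
have L0 : 0 < L by rewrite !mulr_gt0.
pose y := simplex_profile L M (n_ := n_).
have yC : continuous y by exact: continuous_simplex_profile.
pose F s t := simplex t /\ forall nu, B nu (y s) (y t nu).
have [||||s sS Fs] := @kakutani_simplex R _ F.
- move=> x xS.
  have [w Bw] : exists w : profile R n_, forall nu, B nu (y x) (w nu).
    exists (fun nu => xget 0 (B nu (y x))) => nu; apply: xgetPex; exact: B_nonempty.
  have [|nu i|t tS tw] := @simplex_profile_onto R N n_ L M w L0.
  + by rewrite /L ler_pM2l ?mulr_gt0 // ler_nat.
  + by apply: (ZM nu (y x)); case: (Bw nu).
  by exists t; split => // nu; rewrite /y tw; exact: Bw.
- by move=> x xS t [].
- move=> x xS; apply/convex_setP => t t' a a0 a1 [tS tB] [t'S t'B]; split.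
    by have /convex_setP := @convex_simplex R #|{: {nu : N & 'I_(n_ nu)}}|; apply.
  move=> nu; rewrite /y simplex_profile_conv.
  by have /convex_setP := B_convex nu (y x); apply.
- move=> x t xS tS nF.
  (* One failing player suffices: the closed graph of [B nu] excludes a whole neighbourhood. *)
  have [nu nB] : exists nu, ~ B nu (y x) (y t nu).
    by apply: contrapT => /forallNP h; apply: nF; split => // nu; exact: contrapT (h nu).
  have clZ : closed (Z nu (y x)).
    by apply: compact_closed; [exact: norm_hausdorff|exact: X_compact].
  have [[U V] /= [tU xV] UV] := argmin_closed_graph (fpc nu) clZ
    (ZC nu (y x)).1 (ZC nu (y x)).2 nB.
  have nearU : \forall t' \near t, U (y t' nu).
    exact: (yC t _ (continuous_coord tU)).
  have nearV : \forall x' \near x, V (y x') by exact: (yC x _ xV).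
  near=> t' x' => /= x'S [_ /(_ nu)].
  apply: (UV (y t' nu, y x')); split => /=; first by near: t'.
  by near: x'.
exists (P (y s)), (y s); split => //.
- by move=> nu; have [] := Fs.2 nu.
(* The squared Euclidean distance is the sum of the players' [sqdist], so componentwise nearest
   points form a nearest profile of the product. *)
- split => // x Kx; apply: ler_wsqrtr; apply: ler_sum => nu _.
  have sqE u v : \sum_i ((u : profile R n_) nu - v nu) ord0 i ^+ 2 = sqdist (u nu) (v nu).
    by apply: eq_bigr => i _; rewrite !mxE.
  by rewrite !sqE; exact: (P_nearest nu (y s)).2.
- move=> nu w Xw; have [_ /(_ w Xw)] := Fs.2 nu.
  by rewrite /f /= replace_id.
Unshelve. all: by end_near. Qed.
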